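(* Let $N\ge 1$ be an integer and let $x\in(0,1)\setminus\mathbb{Q}$ have $N$-continued fraction expansion $x=[d_1,d_2,d_3,\ldots]_N$. Then the dual NCF sequence $\hat{\omega}(x,N)=\lim_{n\to\infty}\hat{\sigma}_{d_1}\hat{\sigma}_{d_2}\cdots\hat{\sigma}_{d_n}(0)$ is the faithful coding of the $B$-integers for some Cantor real base $B$.
   Context: The $N$-continued fraction expansion $x=[d_1,d_2,d_3,\ldots]_N$ means $x=\cfrac{N}{d_1+\cfrac{N}{d_2+\cdots}}$ with integers $d_n\ge N$. For an integer $d\ge N$, $\hat{\sigma}_d\colon\{0,1\}^*\to\{0,1\}^*$ is the morphism with $\hat{\sigma}_d(0)=0^d1$ and $\hat{\sigma}_d(1)=0^N$. Limits of finite words are taken in the product topology. A Cantor real base is a bi-infinite sequence $B=(\beta_n)_{n\in\mathbb{Z}}$ of real numbers $\beta_n>1$ with $\prod_{n=1}^{+\infty}\beta_n=\prod_{n=1}^{+\infty}\beta_{-n}=+\infty$. For a bi-infinite sequence $\mathbf{a}=(a_n)_{n\in\mathbb{Z}}$ of non-negative integers with $a_n=0$ for all sufficiently large $n$, put $\mathrm{val}_B(\mathbf{a})=\sum_{n=0}^{+\infty}a_n\beta_{n-1}\cdots\beta_0+\sum_{n=1}^{+\infty}\frac{a_{-n}}{\beta_{-1}\cdots\beta_{-n}}$; if this is finite, $\mathbf{a}$ is a $B$-representation of $\mathrm{val}_B(\mathbf{a})$. The $B$-expansion of a non-negative real $y$ is its largest $B$-representation in the radix order, where $\mathbf{a}<_{\mathrm{rad}}\mathbf{b}$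 if there is $i\in\mathbb{Z}$ with $a_j=b_j$ for all $j>i$ and $a_i<b_i$. (Equivalently it is produced by the greedy algorithm.) A non-negative real number $y$ is a $B$-integer if its $B$-expansion $(a_n)_{n\in\mathbb{Z}}$ satisfies $a_n=0$ for all $n<0$. The $B$-integers form a discrete set, listed increasingly as $0=x_0<x_1<x_2<\cdots$. An infinite word $w_0w_1w_2\cdots$ is the faithful coding of the $B$-integers if it encodes the distances between consecutive $B$-integers with precisely one letter per distance, i.e. for all $m,n\ge 0$, $w_m=w_n$ if and only if $x_{m+1}-x_m=x_{n+1}-x_n$ (it is unique up to renaming letters). *)

(* Defs.v *)
From mathcomp Require Import all_boot all_order all_algebra.
From mathcomp Require Import all_classical all_reals all_analysis.

Set Implicit Arguments.
Unset Strict Implicit.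
Unset Printing Implicit Defensive.

Import Order.TTheory GRing.Theory Num.Theory.
Import numFieldNormedType.Exports.

Local Open Scope classical_set_scope.
Local Open Scope ring_scope.

(* Sequences (d_n)_(n >= 1) are indexed from 0: [d n] stands for d_(n+1). *)

(* N/(d_1 + N/(d_2 + ... + N/d_n)), with value 0 for n = 0. *)
Definition ncf_convergent (R : realType) (N : nat) (d : nat -> nat) (n : nat) : R :=
  foldr (fun (e : nat) (t : R) => N%:R / (e%:R + t)) 0 (mkseq d n).

Definition is_ncf_expansion (R : realType) (N : nat) (d : nat -> nat) (x : R) : Prop :=
  (forall n, (N <= d n)%N) /\ ncf_convergent R N d @ \oo --> x.

(* The letters 0 and 1 are [false] and [true]. *)
Definition sigma_hat_letter (N d : nat) (c : bool) : seq bool :=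
  if c then nseq N false else rcons (nseq d false) true.

Definition sigma_hat (N d : nat) (u : seq bool) : seq bool :=
  flatten [seq sigma_hat_letter N d c | c <- u].

(* sigma_hat_(d_1) (sigma_hat_(d_2) (... sigma_hat_(d_n) (0))) *)
Definition dual_ncf_word (N : nat) (d : nat -> nat) (n : nat) : seq bool :=
  foldr (sigma_hat N) [:: false] (mkseq d n).

(* Finite and infinite words both live in the product of copies of the discrete
   space {0,1} + {blank}, finite words being padded by the blank [None]. *)
Definition pad_finite (u : seq bool) : nat -> discrete_topology (option bool) :=
  onth u.

Definition pad_infinite (w : nat -> bool) : nat -> discrete_topology (option bool) :=
  fun k => Some (w k).

Definition is_limit_word (u : nat -> seq bool) (w : nat -> bool) : Prop :=
  {ptws, (fun n => pad_finite (u n)) @ \oo --> pad_infinite w}.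

Section CantorRealBases.
Variable R : realType.
Implicit Types (B : int -> R) (a b : int -> nat) (y : R).

Definition cantor_real_base B : Prop :=
  [/\ forall n, 1 < B n,
      (fun n => \prod_(1 <= i < n.+1) B i%:Z) @ \oo --> +oo
    & (fun n => \prod_(1 <= i < n.+1) B (- i%:Z)) @ \oo --> +oo].

(* Extended-real valued, since the fractional part may diverge. *)
Definition val_base B a : \bar R :=
  (\sum_(0 <= n <oo) ((a n%:Z)%:R * \prod_(0 <= i < n) B i%:Z)%:E
   + \sum_(1 <= n <oo)
       ((a (- n%:Z))%:R / \prod_(1 <= i < n.+1) B (- i%:Z))%:E)%E.

Definition is_representation B a y : Prop :=
  (exists M : int, forall n, M <= n -> a n = 0%N) /\ val_base B a = y%:E.

Definition rad_lt a b : Prop :=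
  exists i : int, (forall j, i < j -> a j = b j) /\ (a i < b i)%N.

Definition is_expansion B a y : Prop :=
  is_representation B a y /\
  forall b, is_representation B b y -> b = a \/ rad_lt b a.

Definition B_integers B : set R :=
  [set y | 0 <= y /\
     exists a, is_expansion B a y /\ forall n : int, n < 0 -> a n = 0%N].

Definition is_increasing_enumeration (A : set R) (x : nat -> R) : Prop :=
  (forall m n, (m < n)%N -> x m < x n) /\ range x = A.

Definition is_faithful_coding (T : Type) B (w : nat -> T) : Prop :=
  exists x : nat -> R,
    [/\ is_increasing_enumeration (B_integers B) x, x 0%N = 0
      & forall m n, w m = w n <-> x m.+1 - x m = x n.+1 - x n].

End CantorRealBases.

(* Main.v *)
Require Import Defs.
From mathcomp Require Import all_boot all_order all_algebra.
From mathcomp Require Import all_classical all_reals all_analysis.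
From mathcomp Require Import ring lra zify.

Import Order.TTheory GRing.Theory Num.Theory.
Import numFieldNormedType.Exports.

Local Open Scope ring_scope.

(* Give the letters 0 and 1 the lengths 1 and 1/2, let u_n be the length of
   W_n = sigma_(d_1) ... sigma_(d_n)(0), and let beta_n = u_(n+1) / u_n for
   n >= 0, so that the integer part of a B-representation is a sum of a_n u_n.
   Whatever the negative half of the base, such a sum is a B-expansion exactly
   when it is greedy: for every m its part of index below m is less than u_m.
   Now W_(n+1) = W_n^(d_(n+1)) V_n with V_n = sigma_(d_1) ... sigma_(d_n)(1) and
   V_(n+1) = W_n^N, and this is also how the greedy sums below u_(n+1) are
   generated: a leading digit less than d_(n+1) leaves the remainder free below
   u_n, while the digit d_(n+1) bounds it by the length of V_n, which is
   N u_(n-1). As N <= d_n, both bounds are compatible with greediness one level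
   down, so the positions of the letters of W_n are the greedy sums below u_n. *)

(** * Iterated morphisms and their limit word *)

Section Words.
Variables (N : nat) (d : nat -> nat).
Implicit Types (u v : seq bool) (n k : nat).

Definition sigma_hat_comp n u : seq bool := foldr (sigma_hat N) u (mkseq d n).

Lemma sigma_hat_comp_cat n u v :
  sigma_hat_comp n (u ++ v) = sigma_hat_comp n u ++ sigma_hat_comp n v.
Proof.
rewrite /sigma_hat_comp; elim: (mkseq d n) => //= e s ->.
by rewrite /sigma_hat map_cat flatten_cat.
Qed.

Lemma sigma_hat_comp_nseq n k c :
  sigma_hat_comp n (nseq k c) = flatten (nseq k (sigma_hat_comp n [:: c])).
Proof.
elim: k => [|k IHk] /=; last by rewrite -cat1s sigma_hat_comp_cat IHk.
by rewrite /sigma_hat_comp; elim: (mkseq d n) => //= e s ->.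
Qed.

(** The innermost morphism, with parameter [d n], acts on a single letter, and the outer ones
    distribute over concatenation. *)
Lemma sigma_hat_comp_false n :
  sigma_hat_comp n.+1 [:: false] =
  flatten (nseq (d n) (sigma_hat_comp n [:: false])) ++ sigma_hat_comp n [:: true].
Proof.
rewrite {1}/sigma_hat_comp mkseqS foldr_rcons -/(sigma_hat_comp _ _).
by rewrite /sigma_hat /= cats0 -cats1 sigma_hat_comp_cat sigma_hat_comp_nseq.
Qed.

Lemma sigma_hat_comp_true n :
  sigma_hat_comp n.+1 [:: true] =
  flatten (nseq N (sigma_hat_comp n [:: false])).
Proof.
rewrite {1}/sigma_hat_comp mkseqS foldr_rcons -/(sigma_hat_comp _ _).
by rewrite /sigma_hat /= cats0 sigma_hat_comp_nseq.
Qed.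

Lemma size_sigma_hat_comp n : (0 < N)%N ->
  (0 < size (sigma_hat_comp n [:: false]))%N /\
  (0 < size (sigma_hat_comp n [:: true]))%N.
Proof.
move=> N_gt0; elim: n => [//|n [IHf IHt]].
rewrite sigma_hat_comp_false sigma_hat_comp_true size_cat addn_gt0 IHt orbT.
by case: N N_gt0 => //= m _; rewrite size_cat addn_gt0 IHf.
Qed.

Hypotheses (N_gt0 : (0 < N)%N) (N_le_d : forall n, (N <= d n)%N).

(** As [d n] is at least 1, a copy of the previous word comes first; the rest contains the nonempty
    image of the letter 1. *)
Lemma dual_ncf_wordS n :
  exists2 v, (0 < size v)%N & dual_ncf_word N d n.+1 = dual_ncf_word N d n ++ v.
Proof.
rewrite -[dual_ncf_word N d n.+1]/(sigma_hat_comp n.+1 [:: false]).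
rewrite sigma_hat_comp_false; case: (d n) (N_le_d n) => [|k] /=; first by lia.
move=> _; rewrite -catA; eexists; last by [].
by rewrite size_cat addn_gt0 (size_sigma_hat_comp n N_gt0).2 orbT.
Qed.

Lemma size_dual_ncf_word n : (n < size (dual_ncf_word N d n))%N.
Proof.
elim: n => [//|n IHn]; have [v v_gt0 ->] := dual_ncf_wordS n.
by rewrite size_cat; lia.
Qed.

Lemma dual_ncf_word_prefix m n : (m <= n)%N ->
  exists v, dual_ncf_word N d n = dual_ncf_word N d m ++ v.
Proof.
move=> /subnK <-; elim: (n - m)%N => [|k [v IHk]].
  by exists [::]; rewrite cats0.
by have [w _ ->] := dual_ncf_wordS (k + m); rewrite IHk -catA; eexists.
Qed.

(** The word of level [k] has more than [k] letters and is a prefix of all later ones, so its letter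
    [k] is final and the default [false] is never reached. *)
Definition dual_ncf_limit k : bool := nth false (dual_ncf_word N d k) k.

Lemma onth_dual_ncf_word n k : (k <= n)%N ->
  onth (dual_ncf_word N d n) k = Some (dual_ncf_limit k).
Proof.
move=> /dual_ncf_word_prefix[v ->]; rewrite onth_cat size_dual_ncf_word.
by rewrite onthE (nth_map false) ?size_dual_ncf_word.
Qed.

Lemma dual_ncf_limitE n k : (k < size (dual_ncf_word N d n))%N ->
  nth false (dual_ncf_word N d n) k = dual_ncf_limit k.
Proof.
move=> k_lt; have [v e] := dual_ncf_word_prefix n _ (leq_maxl n k).
have := onth_dual_ncf_word (maxn n k) k (leq_maxr _ _).
by rewrite e onth_cat k_lt => /(onth_nth false).
Qed.

Lemma dual_ncf_limitP : is_limit_word (dual_ncf_word N d) dual_ncf_limit.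
Proof.
apply/pointwise_cvgP => k; apply: cvg_near_cst.
exists k => // n /= k_le_n; exact: onth_dual_ncf_word.
Qed.

End Words.

(** * Lengths of words and positions of letters *)

Section Lengths.
Variable R : realType.
Implicit Types (u v : seq bool) (y : R) (k : nat).

(* Any value in (0, 1) would do for the length of the letter 1. *)
Definition letter_length (c : bool) : R := if c then 2^-1 else 1.

Definition word_length u : R := \sum_(c <- u) letter_length c.

Lemma letter_length_gt0 c : 0 < letter_length c.
Proof. by case: c => /=; lra. Qed.

Lemma letter_length_inj : injective letter_length.
Proof. by case=> [] [] //=; lra. Qed.

Lemma word_length_cat u v : word_length (u ++ v) = word_length u + word_length v.
Proof. exact: big_cat. Qed.

Lemma word_length_flatten_nseq k v :
  word_length (flatten (nseq k v)) = k%:R * word_length v.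
Proof.
elim: k => [|k IHk] /=; first by rewrite mul0r /word_length big_nil.
by rewrite word_length_cat IHk -natr1; ring.
Qed.

(** Letters are laid out as consecutive intervals from 0 and [y] is a left endpoint. The right end
    of the word is excluded, so that in a concatenation each position belongs to exactly one
    factor. *)
Definition is_position u y : Prop :=
  exists2 k, (k < size u)%N & y = word_length (take k u).

Lemma is_position_cat u v y :
  is_position (u ++ v) y <-> is_position u y \/ is_position v (y - word_length u).
Proof.
split=> [[k k_lt ->]|[[k k_lt ->]|[k k_lt yE]]].
- rewrite take_cat; case: ltnP => k_u; first by left; exists k.
  right; exists (k - size u)%N; first by move: k_lt; rewrite size_cat; lia.
  by rewrite word_length_cat addrC addKr.
- by exists k; rewrite ?size_cat ?take_cat ?k_lt //; lia.
- exists (size u + k)%N; rewrite ?size_cat; first by lia.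
  by rewrite take_cat ltnNge leq_addr /= addKn word_length_cat -yE; ring.
Qed.

Lemma is_position_flatten_nseq k v y :
  is_position (flatten (nseq k v)) y <->
  exists2 j, (j < k)%N & is_position v (y - j%:R * word_length v).
Proof.
elim: k y => [|k IHk] y /=; first by split=> -[].
rewrite is_position_cat IHk; split=> [[vy|[j j_lt vy]]|[[|j] j_lt vy]].
- by exists 0%N => //; rewrite mul0r subr0.
- exists j.+1 => //; move: vy; congr is_position.
  by rewrite -natr1; ring.
- by left; rewrite mul0r subr0 in vy.
- right; exists j => //; move: vy; congr is_position.
  by rewrite -natr1; ring.
Qed.

End Lengths.

(** * Greedy sums over a sequence of place values *)

Section GreedySums.
Variables (R : realType) (u : nat -> R).
Implicit Types (y z : R) (n m : nat).

Definition is_greedy_sum n y : Prop :=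
  exists2 a : nat -> nat, y = \sum_(i < n) (a i)%:R * u i
    & forall m, (m <= n)%N -> \sum_(i < m) (a i)%:R * u i < u m.

Lemma is_greedy_sum0 y : 0 < u 0%N -> is_greedy_sum 0 y <-> y = 0.
Proof.
move=> u0; split=> [[a -> _]|->]; first by rewrite big_ord0.
by exists (fun=> 0%N) => [|[]//]; rewrite big_ord0.
Qed.

(** The bounds of index at most [n] concern only the lower digits, so the leading digit is
    restrained by [y < u n.+1] alone. *)
Lemma is_greedy_sumS n y :
  is_greedy_sum n.+1 y <->
  y < u n.+1 /\ exists c : nat, is_greedy_sum n (y - c%:R * u n).
Proof.
split=> [[a yE a_lt]|[y_lt [c [a yE a_lt]]]].
  split; first by rewrite yE; exact: a_lt.
  exists (a n), a => [|m m_le]; last exact/a_lt/leqW.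
  by rewrite yE big_ord_recr /= addrK.
pose b i := if i == n then c else a i.
have bE m : (m <= n)%N ->
    \sum_(i < m) (b i)%:R * u i = \sum_(i < m) (a i)%:R * u i.
  move=> m_le; apply: eq_bigr => i _; rewrite /b ifN //.
  by have := ltn_ord i; lia.
have yE' : y = \sum_(i < n.+1) (b i)%:R * u i.
  by rewrite big_ord_recr /= bE // -yE /b eqxx subrK.
exists b => // m; rewrite leq_eqVlt ltnS => /orP[/eqP ->|m_le].
  by rewrite -yE'.
by rewrite bE //; exact: a_lt.
Qed.

Hypothesis u_gt0 : forall n, 0 < u n.

Lemma is_greedy_sum_bounds n y : is_greedy_sum n y -> 0 <= y < u n.
Proof.
move=> [a -> a_lt]; rewrite a_lt // andbT.
by apply: sumr_ge0 => i _; rewrite mulr_ge0 // ltW.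
Qed.

Hypothesis u_mono : forall n, u n < u n.+1.

Lemma is_greedy_sum_leq m n y : (m <= n)%N ->
  is_greedy_sum m y -> is_greedy_sum n y.
Proof.
move=> /subnK <-; elim: (n - m)%N => [//|k IHk] /IHk gy.
apply/is_greedy_sumS; split; last by exists 0%N; rewrite mul0r subr0.
by rewrite (lt_trans _ (u_mono _)) //; case/andP: (is_greedy_sum_bounds _ _ gy).
Qed.

End GreedySums.

(** The digits of [a] below [i] weigh less than one unit of place [i], so they cannot make up for
    the larger digit of [b] there. *)
Lemma lt_sum_lex (R : realType) (u : nat -> R) (a b : nat -> nat) (i L : nat) :
  (forall n, 0 < u n) -> \sum_(k < i) (a k)%:R * u k < u i ->
  (i < L)%N -> (a i < b i)%N -> (forall k, (i < k)%N -> a k = b k) ->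
  \sum_(k < L) (a k)%:R * u k < \sum_(k < L) (b k)%:R * u k.
Proof.
move=> u_gt0 a_lt iL ai_lt ab; rewrite -(subnK iL).
elim: (L - i.+1)%N => [|k IHk]; last first.
  by rewrite addSn !big_ord_recr /= ab ?ltrD2r //; lia.
rewrite add0n !big_ord_recr /=.
have b_ge0 : 0 <= \sum_(k < i) (b k)%:R * u k.
  by apply: sumr_ge0 => k _; rewrite mulr_ge0 // ltW.
have : ((a i).+1)%:R * u i <= (b i)%:R * u i by rewrite ler_pM2r // ler_nat.
rewrite -natr1 mulrDl mul1r; lra.
Qed.

Lemma sum_indicator (R : realType) (u : nat -> R) (m L : nat) : (m < L)%N ->
  \sum_(i < L) (i == m :> nat)%:R * u i = u m.
Proof.
move=> mL; rewrite (bigD1 (Ordinal mL)) //= eqxx mul1r big1 ?addr0 // => i.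
by rewrite -val_eqE /= => /negbTE ->; rewrite mul0r.
Qed.

(** Used to fill the fractional half of a representation, where the base will be 2. The digits come
    from the truncations of [2 ^+ n * z], so that their sum telescopes. *)
Lemma binary_expansion (R : realType) (z : R) : 0 <= z ->
  exists (c : nat) (e : nat -> nat),
    (\sum_(1 <= n <oo) ((e n)%:R / 2 ^+ n)%:E)%E = (z - c%:R)%:E.
Proof.
move=> z_ge0; pose f n := Num.truncn (2 ^+ n * z).
exists (f 0%N), (fun n => f n - (f n.-1).*2)%N.
have f_itv n : (f n)%:R <= 2 ^+ n * z < (f n)%:R + 1.
  by rewrite natr1; apply: truncn_itv; rewrite mulr_ge0 // exprn_ge0.
(* This makes the natural subtraction in the digits exact. *)
have f_dbl n : ((f n).*2 <= f n.+1)%N.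
  rewrite -ltnS -(ltr_nat R) -muln2 natrM.
  have := f_itv n; have := f_itv n.+1; rewrite -natr1 exprS; lra.
have sumE n : \sum_(1 <= k < n.+1) (f k - (f k.-1).*2)%:R / 2 ^+ k
    = (f n)%:R / 2 ^+ n - (f 0%N)%:R :> R.
  rewrite -[(f 0%N)%:R]divr1 -[X in _ - _ / X](expr0 2).
  rewrite -(@telescope_sumr _ 0 n (fun k => (f k)%:R / 2 ^+ k)) // big_add1.
  apply: eq_bigr => k _ /=; rewrite natrB // -muln2 natrM exprS.
  have : 2 ^+ k != 0 :> R by rewrite expf_neq0.
  by move=> ?; field.
have lim_f : ((f n)%:R / 2 ^+ n @[n --> \oo] --> z)%classic.
  have geo : ((2^-1 : R) ^+ n @[n --> \oo] --> 0)%classic.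
    by apply: cvg_expr; rewrite ger0_norm; lra.
  apply: (@squeeze_cvgr _ _ _ _ (fun n => z - 2^-1 ^+ n) (fun=> z)).
  - apply: nearW => n; have p : 0 < 2 ^+ n :> R by rewrite exprn_gt0.
    rewrite ler_pdivlMr // ler_pdivrMr // mulrBl exprVn mulVf ?gt_eqF //.
    by have := f_itv n; rewrite mulrC; lra.
  - have := cvgB (cvg_cst z) geo; rewrite subr0 => zg; exact: zg.
  - exact: cvg_cst.
apply: cvg_lim => //; rewrite -cvg_shiftS.
have -> : [sequence (\sum_(1 <= k < n.+1)
      ((f k - (f k.-1).*2)%:R / 2 ^+ k)%:E)%E]_n =
    (fun n => ((f n)%:R / 2 ^+ n - (f 0%N)%:R : R)%:E).
  by apply/funext => n /=; rewrite sumEFin sumE.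
apply: cvg_EFin; first by apply: nearW.
by apply: cvgB => //; exact: cvg_cst.
Qed.

(** * The base with prescribed place values, and its integers *)

Section Base.
Variables (R : realType) (u : nat -> R).
Implicit Types (a b : int -> nat) (y : R).

(* The digits of negative index play no role in the B-integers, so that the
   base may be chosen arbitrarily there. *)
Definition cantor_base_of (n : int) : R :=
  if n is Posz k then u k.+1 / u k else 2.

Hypotheses (u0 : u 0%N = 1) (u_gt0 : forall n, 0 < u n).

Lemma prod_cantor_base_nat m n : (m <= n)%N ->
  \prod_(m <= i < n) cantor_base_of i%:Z = u n / u m.
Proof.
rewrite leq_eqVlt => /orP[/eqP <-|mn].
  by rewrite big_geq // divff // gt_eqF.
by rewrite -(@telescope_prodf _ m n u) // => k _; rewrite gt_eqF.
Qed.

Lemma prod_cantor_base_neg n :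
  \prod_(1 <= i < n.+1) cantor_base_of (- i%:Z) = 2 ^+ n.
Proof.
by rewrite big_add1 /= (eq_bigr (fun=> 2)) ?prodr_const_nat ?subn0.
Qed.

Hypotheses (u_mono : forall n, u n < u n.+1) (u_oo : (u @ \oo --> +oo)%classic).

Lemma cantor_real_base_of : cantor_real_base cantor_base_of.
Proof.
split=> [[n|n]||].
- by rewrite /= ltr_pdivlMr // mul1r.
- by rewrite /= ltr1n.
(* The product required to diverge starts at index 1, whence the divisor [u 1]. *)
- have -> : (fun n => \prod_(1 <= i < n.+1) cantor_base_of i%:Z) =
      (fun n => u n.+1 / u 1%N).
    by apply/funext => n; rewrite prod_cantor_base_nat.
  have u1V : 0 < (u 1%N)^-1 by rewrite invr_gt0.
  apply/cvgryPge => A.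
  have := u_oo; rewrite -cvg_shiftS => /cvgryPge/(_ (A * u 1%N)).
  by apply: filterS => n; rewrite ler_pdivlMr.
have -> : (fun n => \prod_(1 <= i < n.+1) cantor_base_of (- i%:Z)) =
    (fun n => 2 ^+ n).
  by apply/funext => n; rewrite prod_cantor_base_neg.
apply: (@ger_cvgy _ _ _ _ (fun n : nat => n%:R) (fun n => 2 ^+ n)).
  by apply: nearW => n; rewrite -natrX ler_nat ltnW // ltn_expl.
exact: cvgr_idn.
Qed.

Definition int_part a (n : nat) : \bar R := ((a n%:Z)%:R * u n)%:E.
Definition frac_part a (n : nat) : \bar R := ((a (- n%:Z))%:R / 2 ^+ n)%:E.

Lemma val_cantor_baseE a :
  val_base cantor_base_of a =
  (\sum_(0 <= n <oo) int_part a n + \sum_(1 <= n <oo) frac_part a n)%E.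
Proof.
rewrite /val_base; congr (_ + _)%E; apply: eq_eseriesr => n _.
  by rewrite prod_cantor_base_nat // u0 divr1.
by rewrite prod_cantor_base_neg.
Qed.

Lemma int_part_ge0 a n : (0 <= int_part a n)%E.
Proof. by rewrite lee_fin mulr_ge0 // ltW. Qed.

Lemma frac_part_ge0 a n : (0 <= frac_part a n)%E.
Proof. by rewrite lee_fin divr_ge0 // exprn_ge0. Qed.

Lemma int_part_sum a (M : nat) :
  (forall n, (M <= n)%N -> a n%:Z = 0%N) ->
  (\sum_(0 <= n <oo) int_part a n = (\sum_(n < M) (a n%:Z)%:R * u n)%:E)%E.
Proof.
move=> aM; rewrite (nneseries_split 0 M) => [|k _]; last exact: int_part_ge0.
rewrite add0n eseries0 ?adde0 => [|k Mk _]; last first.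
  by rewrite /int_part aM // mul0r.
by rewrite big_mkord sumEFin.
Qed.

Lemma representation_support {b y} : is_representation cantor_base_of b y ->
  exists M : nat, forall n, (M <= n)%N -> b n%:Z = 0%N.
Proof. by move=> [[M bM] _]; exists `|M|%N => n Mn; apply: bM; lia. Qed.

(** All terms are nonnegative, so finitely many of them stay below the value. Keeping one fractional
    digit shows that it must vanish once the integer part already reaches [y]. *)
Lemma representation_ge b y (M : nat) (k : nat) :
  is_representation cantor_base_of b y ->
  \sum_(n < M) (b n%:Z)%:R * u n + (b (Negz k))%:R / 2 ^+ k.+1 <= y.
Proof.
move=> [_]; rewrite val_cantor_baseE -lee_fin => <-.
rewrite EFinD; apply: leeD.
  rewrite -sumEFin -(big_mkord xpredT (int_part b)).
  by apply: nneseries_lim_ge => n _ _; exact: int_part_ge0.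
apply: le_trans (@nneseries_lim_ge _ _ xpredT 1 k.+2 _); last first.
  by move=> n _ _; exact: frac_part_ge0.
rewrite big_nat_recr //= leeDr //.
by apply: sume_ge0 => i _; exact: frac_part_ge0.
Qed.

(** The greedy digits, extended by zeros, form the expansion. A rival with the same nonnegative
    digits has no room for fractional ones; otherwise the largest nonnegative index of disagreement
    decides. *)
Lemma greedy_is_B_integer n y :
  is_greedy_sum R u n y -> B_integers cantor_base_of y.
Proof.
move=> gy; have /andP[y_ge0 _] := is_greedy_sum_bounds _ _ u_gt0 _ _ gy.
have [c yE c_lt] := gy.
pose a (i : int) := if i is Posz k then if (k < n)%N then c k else 0%N else 0%N.
have a_big k : (n <= k)%N -> a k%:Z = 0%N by rewrite /a leqNgt => /negbTE ->.
have aE m : (m <= n)%N ->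
    \sum_(i < m) (a i%:Z)%:R * u i = \sum_(i < m) (c i)%:R * u i.
  move=> mn; apply: eq_bigr => i _; rewrite /a.
  by rewrite ifT //; have := ltn_ord i; lia.
split=> //; exists a; split=> [|[]//].
split.
  split; first by exists n%:Z => -[k|//]; rewrite lez_nat => /a_big.
  rewrite val_cantor_baseE (int_part_sum _ n) // aE // -yE.
  rewrite eseries0 ?adde0 // => k k_gt0 _.
  by rewrite /frac_part; case: k k_gt0 => // k _; rewrite -NegzE /= mul0r.
have yaE m : (n <= m)%N -> \sum_(i < m) (a i%:Z)%:R * u i = y.
  move=> nm; rewrite yE -aE // -(subnK nm); elim: (m - n)%N => [//|k IHk].
  by rewrite addSn big_ord_recr IHk a_big ?leq_addl // mul0r; exact: addr0.
have a_lt m : \sum_(i < m) (a i%:Z)%:R * u i < u m.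
  have [mn|/ltnW nm] := leqP m n; first by rewrite aE //; exact: c_lt.
  rewrite yaE //; have := is_greedy_sum_leq _ _ u_gt0 u_mono _ _ _ nm gy.
  by case/(is_greedy_sum_bounds _ _ u_gt0)/andP.
move=> b b_rep; have [M bM] := representation_support b_rep.
have [[k ab]|ab] := pselect (exists k : nat, a k%:Z != b k%:Z); last first.
  left; apply/funext => -[k|k].
    by apply/esym/eqP; apply: contra_notT ab => ab; exists k.
  apply/eqP/negPn/negP; rewrite -lt0n => b_gt0.
  have := representation_ge b y n k b_rep.
  rewrite (eq_bigr (fun i : 'I_n => (a i%:Z)%:R * u i)) => [|i _]; last first.
    by congr (_%:R * _); apply/esym/eqP; apply: contra_notT ab => ab; exists i.
  have : 0 < (b (Negz k))%:R / 2 ^+ k.+1 :> R.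
    by rewrite divr_gt0 ?ltr0n // exprn_gt0.
  by rewrite yaE //; lra.
have ex_ab : exists k : nat, a k%:Z != b k%:Z by exists k.
(* From [L] on both digit sequences vanish, so a largest index of disagreement exists. *)
pose L := maxn n M.
have ab_le i : a i%:Z != b i%:Z -> (i <= L)%N.
  apply: contraNT; rewrite -ltnNge /L => iL.
  by rewrite a_big ?bM //; lia.
case: (ex_maxnP ex_ab ab_le) => i ab_i i_max.
have ab_eq j : (i < j)%N -> a j%:Z = b j%:Z.
  move=> ij; apply/eqP/negPn/negP => /i_max; lia.
have [ba|ba|ba] := ltngtP (b i%:Z) (a i%:Z); last by rewrite ba eqxx in ab_i.
  by right; exists i%:Z; split=> // -[j|//]; rewrite ltz_nat => /ab_eq.
(* Here [b] has the larger digit at the top disagreement, so its integer part alone would exceed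
   [y]. *)
have iL := ab_le i ab_i.
have := @lt_sum_lex _ _ (fun k => a k%:Z) (fun k => b k%:Z) i L.+1 u_gt0 (a_lt i).
move=> /(_ iL ba ab_eq); rewrite yaE => [|]; last by rewrite /L; lia.
have := representation_ge b y L.+1 0%N b_rep.
have frac_ge0 : 0 <= (b (Negz 0))%:R / 2 ^+ 1 :> R by rewrite divr_ge0.
by move=> sum_le; rewrite ltNge (le_trans _ sum_le) // lerDl.
Qed.

Lemma B_integer_is_greedy y :
  B_integers cantor_base_of y -> exists n, is_greedy_sum R u n y.
Proof.
move=> [y_ge0 [a [[a_rep a_max] a_neg]]].
have [M aM] := representation_support a_rep.
have yE L : (M <= L)%N -> y = \sum_(i < L) (a i%:Z)%:R * u i.
  move=> ML; have [_] := a_rep; rewrite val_cantor_baseE.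
  rewrite (int_part_sum _ L) => [|k Lk]; last by apply: aM; exact: leq_trans Lk.
  rewrite eseries0 ?adde0 => [[]//|k k_gt0 _].
  by rewrite /frac_part a_neg ?mul0r //; lia.
exists M, (fun i => a i%:Z) => [|m _]; first exact: yE.
rewrite ltNge; apply/negP => u_le.
(* Carrying [u m] over to the digit [m], and writing what is left of the part
   below [m] with units and binary fractional digits, gives a representation
   larger than the expansion [a]. *)
have rest_ge0 : 0 <= \sum_(i < m) (a i%:Z)%:R * u i - u m by rewrite subr_ge0.
have [c [e eE]] := binary_expansion R _ rest_ge0.
pose b (j : int) : nat := if j is Posz k
  then ((m <= k) * a k%:Z + ((k == m) + (k == 0) * c))%N else e `|j|%N.
pose L := maxn M m.+1.
have sum_a : \sum_(i < L) ((m <= i) * a i%:Z)%:R * u i =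
    y - \sum_(i < m) (a i%:Z)%:R * u i.
  rewrite (yE L) /L ?leq_maxl //.
  rewrite -(big_mkord xpredT (fun i => ((m <= i) * a i%:Z)%:R * u i)).
  rewrite -!(big_mkord xpredT (fun i => (a i%:Z)%:R * u i)).
  rewrite (@big_cat_nat _ _ _ m) //=; last by lia.
  rewrite [in RHS](@big_cat_nat _ _ _ m) //=; last by lia.
  rewrite addrAC subrr add0r big_nat big1 ?add0r => [|i /andP[_ im]].
    by apply: eq_big_nat => i /andP[mi _]; rewrite mi mul1n.
  by rewrite leqNgt im mul0n mul0r.
have b_rep : is_representation cantor_base_of b y.
  have bL k : (L <= k)%N -> b k%:Z = 0%N.
    by move=> Lk; rewrite /b aM; lia.
  split; first by exists L%:Z => -[k|//]; rewrite lez_nat => /bL.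
  rewrite val_cantor_baseE (int_part_sum _ L) //.
  have -> : (\sum_(1 <= n <oo) frac_part b n)%E =
      (\sum_(i < m) (a i%:Z)%:R * u i - u m - c%:R)%:E.
    rewrite -eE; apply: congr_lim; apply/funext => k /=.
    by rewrite big_nat [RHS]big_nat; apply: eq_bigr => -[|i].
  rewrite -EFinD; congr EFin.
  rewrite (eq_bigr (fun i : 'I_L => ((m <= i)%N * a i%:Z)%:R * u i +
    ((i == m :> nat)%:R * u i + c%:R * ((i == 0%N :> nat)%:R * u i)))); last first.
    by move=> i _; rewrite /b !natrD [((i == 0%N :> nat) * c)%:R]natrM; ring.
  rewrite !big_split /= sum_a -mulr_sumr !sum_indicator /L; try lia.
  by rewrite u0; ring.
(* From place [m] upwards no digit of [b] is below that of [a], and the one at [m] is larger. A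
   first smaller digit of [b] would thus lie below [m], which would force equality at [m]. *)
have b_neq_a : b m%:Z <> a m%:Z by rewrite /b leqnn eqxx; lia.
case: (a_max b b_rep) => [ba|[i [ab_gt ab_lt]]]; first by rewrite ba in b_neq_a.
have [im|mi] := ltP i m%:Z; first by rewrite ab_gt in b_neq_a.
by case: i mi ab_lt {ab_gt} => [i|//] mi; rewrite /b; lia.
Qed.

End Base.

(** * Letter positions as greedy sums, and the coding *)

Section Coding.
Variables (R : realType) (N : nat) (d : nat -> nat).
Hypotheses (N_gt0 : (0 < N)%N) (N_le_d : forall n, (N <= d n)%N).
Implicit Types (y : R) (n k : nat).

Definition len0 n : R := word_length R (sigma_hat_comp N d n [:: false]).
Definition len1 n : R := word_length R (sigma_hat_comp N d n [:: true]).

Lemma len00 : len0 0 = 1.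
Proof. by rewrite /len0 /word_length big_seq1. Qed.

Lemma len10 : len1 0 = 2^-1.
Proof. by rewrite /len1 /word_length big_seq1. Qed.

Lemma len0S n : len0 n.+1 = (d n)%:R * len0 n + len1 n.
Proof.
by rewrite {1}/len0 sigma_hat_comp_false word_length_cat word_length_flatten_nseq.
Qed.

Lemma len1S n : len1 n.+1 = N%:R * len0 n.
Proof. by rewrite {1}/len1 sigma_hat_comp_true word_length_flatten_nseq. Qed.

(** The order persists because [N] copies of the word for 0 are at most [d n] copies, and the next
    word for 0 has a further factor of positive length. *)
Lemma len_itv n : 0 < len1 n < len0 n.
Proof.
elim: n => [|n /andP[len1_gt0 len1_lt]]; first by rewrite len00 len10; lra.
have len0_gt0 := lt_trans len1_gt0 len1_lt.
rewrite len0S len1S mulr_gt0 ?ltr0n //=.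
have : N%:R * len0 n <= (d n)%:R * len0 n by rewrite ler_pM2r // ler_nat.
lra.
Qed.

Lemma len0_gt0 n : 0 < len0 n.
Proof. by have /andP[h1 h2] := len_itv n; exact: lt_trans h1 h2. Qed.

Lemma len0_le_dlen0 n : len0 n <= (d n)%:R * len0 n.
Proof.
by rewrite ler_pMl ?len0_gt0 // ler1n; exact: leq_trans N_gt0 (N_le_d n).
Qed.

Lemma len0_mono n : len0 n < len0 n.+1.
Proof. by have := len0_le_dlen0 n; have := len_itv n; rewrite len0S; lra. Qed.

(** The shift avoids the initial length 1/2; from level 1 on, each step then adds at least 1 to
    [len0], which gives its divergence. *)
Lemma len1S_ge1 n : 1 <= len1 n.+1.
Proof.
rewrite len1S; apply: mulr_ege1; first by rewrite ler1n.
elim: n => [|n IHn]; first by rewrite len00.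
exact: le_trans IHn (ltW (len0_mono n)).
Qed.

Lemma len0_cvgy : (len0 @ \oo --> +oo)%classic.
Proof.
rewrite -cvg_shiftS; apply: (@ger_cvgy _ _ _ _ (fun n : nat => n%:R)) cvgr_idn.
apply: nearW => n; elim: n => [|n IHn] /=; first exact/ltW/len0_gt0.
have := len0_le_dlen0 n.+1; have := len1S_ge1 n; rewrite [len0 n.+2]len0S -natr1.
move: IHn => /=; lra.
Qed.

(** The two letters need a joint induction, since the word for 0 ends with the word for 1 of the
    level below. The number of the copy of the word for 0 that contains a position is the leading
    digit. *)
Lemma is_position_greedy n y :
  (is_position R (sigma_hat_comp N d n [:: false]) y <->
     is_greedy_sum R len0 n y) /\
  (is_position R (sigma_hat_comp N d n [:: true]) y <->
     is_greedy_sum R len0 n y /\ y < len1 n).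
Proof.
elim: n y => [|n IHn] y.
  have pos0 c : is_position R (sigma_hat_comp N d 0 [:: c]) y <-> y = 0.
    split=> [[[|//] _ ->]|->]; first by rewrite take0 /word_length big_nil.
    by exists 0%N; rewrite ?take0 /word_length ?big_nil.
  rewrite !pos0 is_greedy_sum0 ?len0_gt0 //; split=> //.
  by split=> [->|[]//]; split=> //; case/andP: (len_itv 0).
have IH0 z := (IHn z).1; have IH1 z := (IHn z).2; clear IHn.
have bounds z := is_greedy_sum_bounds R len0 len0_gt0 n z.
have /andP[len1_gt0 len1_lt] := len_itv n.
have digit_lt (c k : nat) z : is_greedy_sum R len0 n (z - c%:R * len0 n) ->
    z < k%:R * len0 n -> (c < k)%N.
  move=> /bounds/andP[z_ge0 _] z_lt.
  rewrite -(ltr_nat R) -(ltr_pM2r (len0_gt0 n)); lra.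
have lt_digit (c k : nat) z : is_greedy_sum R len0 n (z - c%:R * len0 n) ->
    (c < k)%N -> z < k%:R * len0 n.
  move=> /bounds/andP[_ z_lt]; rewrite -(ler_nat R).
  rewrite -(ler_pM2r (len0_gt0 n)) -natr1; lra.
rewrite sigma_hat_comp_false sigma_hat_comp_true is_position_cat.
rewrite !is_position_flatten_nseq word_length_flatten_nseq -/(len0 n).
rewrite is_greedy_sumS len0S len1S IH1; split; split.
- case=> [[c c_lt /IH0 gz]|[gz z_lt]]; last by split; [lra | exists (d n)].
  by split; [have := lt_digit _ _ _ gz c_lt; lra | exists c].
- move=> [y_lt [c gz]].
  (* As [len1 n < len0 n], the bound on [y] leaves digits up to [d n]: a smaller one selects a copy
     of the word for 0, the digit [d n] the final word for 1. *)
  have : (c < (d n).+1)%N by apply: digit_lt gz _; rewrite -natr1; lra.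
  rewrite ltnS leq_eqVlt => /orP[/eqP cE|c_lt].
    by right; rewrite -cE; split=> //; rewrite cE; lra.
  by left; exists c => //; apply/IH0.
- move=> [c c_lt /IH0 gz]; have y_lt := lt_digit _ _ _ gz c_lt.
  split=> //; split; last by exists c.
  have : N%:R * len0 n <= (d n)%:R * len0 n.
    by rewrite ler_pM2r ?len0_gt0 // ler_nat.
  lra.
- move=> [[_ [c gz]] y_lt]; exists c; first exact: digit_lt gz y_lt.
  exact/IH0.
Qed.

Definition coding_point n : R :=
  \sum_(k < n) letter_length R (dual_ncf_limit N d k).

Lemma coding_pointE n k : (k <= size (dual_ncf_word N d n))%N ->
  word_length R (take k (dual_ncf_word N d n)) = coding_point k.
Proof.
move=> k_le; rewrite /word_length (big_nth false) size_takel // big_mkord.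
apply: eq_bigr => i _; rewrite nth_take // dual_ncf_limitE //.
exact: leq_trans (ltn_ord i) k_le.
Qed.

(** Position [k] of the limit word is already a position in the word of level [k], and conversely
    each finite word is a prefix of the limit. *)
Lemma range_coding_point y :
  (exists k, coding_point k = y) <-> exists n, is_greedy_sum R len0 n y.
Proof.
split=> [[k <-]|[n]].
  have k_lt := size_dual_ncf_word N d N_gt0 N_le_d k.
  exists k; apply/(is_position_greedy k _).1; exists k => //.
  by rewrite -(coding_pointE k) // ltnW.
move=> /(is_position_greedy n y).1[k k_lt ->].
by exists k; rewrite -(coding_pointE n) // ltnW.
Qed.

(** Consecutive points differ by the length of a letter: positivity of lengths orders the points,
    and injectivity makes the coding faithful. *)
Lemma dual_ncf_limit_faithful :
  is_faithful_coding (cantor_base_of R len0) (dual_ncf_limit N d).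
Proof.
have pointS k : coding_point k.+1 - coding_point k =
    letter_length R (dual_ncf_limit N d k).
  by rewrite /coding_point big_ord_recr addrC addKr.
exists coding_point; split; last 2 first.
- by rewrite /coding_point big_ord0.
- by move=> m n; rewrite !pointS; split=> [->//|/letter_length_inj].
split.
  apply: (homo_ltn lt_trans) => k.
  by rewrite -subr_gt0 pointS letter_length_gt0.
apply/seteqP; split=> y.
  move=> [k _ yE]; have [n gy] := (range_coding_point y).1 (ex_intro _ k yE).
  exact: greedy_is_B_integer len00 len0_gt0 len0_mono _ _ gy.
move=> /(B_integer_is_greedy _ _ len00 len0_gt0).
by move=> /range_coding_point[k yE]; exists k.
Qed.

End Coding.

Theorem corollary28 (R : realType) (N : nat) (x : R) (d : nat -> nat)
    (hN : (1 <= N)%N) (hx0 : 0 < x) (hx1 : x < 1)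
    (hxirr : irrational x) (hd : is_ncf_expansion N d x) :
  exists omega : nat -> bool,
    is_limit_word (dual_ncf_word N d) omega /\
    exists B : int -> R, cantor_real_base B /\ is_faithful_coding B omega.
Proof.
have [N_le_d _] := hd.
exists (dual_ncf_limit N d); split; first exact: dual_ncf_limitP.
exists (cantor_base_of R (len0 R N d)); split.
  apply: cantor_real_base_of.
  - exact: len0_gt0.
  - exact: len0_mono.
  - exact: len0_cvgy.
exact: dual_ncf_limit_faithful.
Qed.
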